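(* Let $L$ be an $n$-Lie algebra over $\mathbb{K}$ such that the Lie algebra $\mathrm{InnDer}(L)$ of inner derivations of $L$ is abelian. Then $(\Lambda^{n-1}L,\circ)$ is a Lie algebra.
   Context: $\mathbb{K}$ is a commutative unital ring in which $2$ is invertible, and $n\geq 2$. An $n$-Lie algebra over $\mathbb{K}$ is a $\mathbb{K}$-module $L$ with an $n$-linear alternating bracket $[-,\dots,-]\colon L^n\to L$ (it vanishes whenever two of its arguments are equal) satisfying $$\big[[x_1,\dots,x_n],y_1,\dots,y_{n-1}\big]=\sum_{i=1}^n\big[x_1,\dots,x_{i-1},[x_i,y_1,\dots,y_{n-1}],x_{i+1},\dots,x_n\big]$$ for all $x_i,y_i\in L$. For $x=x_1\wedge\dots\wedge x_{n-1}\in\Lambda^{n-1}L$ the adjoint action $\mathrm{ad}_x\colon L\to L$ is $\mathrm{ad}_x(b)=[x_1,\dots,x_{n-1},b]$, extended linearly to all $x\in\Lambda^{n-1}L$. Each $\mathrm{ad}_x$ is a derivation of $L$, called an inner derivation; $\mathrm{InnDer}(L)$ is the $\mathbb{K}$-module spanned by all of them, a Lie algebra under the commutator $[d_1,d_2]=d_1d_2-d_2d_1$. The same notation $\mathrm{ad}_x$ is used for the extension by derivation to tensor and exterior powers: $\mathrm{ad}_x(y_1\wedge\dots\wedge y_{n-1})=\sum_{k}y_1\wedge\dots\wedge\mathrm{ad}_x(y_k)\wedge\dots\wedge y_{n-1}$. The product $\circ$ on $\Lambda^{n-1}L$ is the bilinear operation $$x\circ y=\tfrac12\bigl(\mathrm{ad}_x(y)-\mathrm{ad}_y(x)\bigr).$$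 ''$(\Lambda^{n-1}L,\circ)$ is a Lie algebra'' means that $\circ$, as bracket, makes the $\mathbb{K}$-module $\Lambda^{n-1}L$ a Lie algebra over $\mathbb{K}$. *)

(* Defs.v *)
From HB Require Import structures.
From mathcomp Require Import all_boot all_order all_algebra.
From mathcomp Require Import generic_quotient boolp.

Set Implicit Arguments.
Unset Strict Implicit.
Unset Printing Implicit Defensive.

Import GRing.Theory.

Local Open Scope ring_scope.
Local Open Scope quotient_scope.

(* Base rings are [comPzRingType]s (the zero ring is allowed), and families    *)
(* (x_1, ..., x_m) of elements of L are finite functions {ffun 'I_m -> L},     *)
(* indexed from 0.                                                             *)

Section Families.
Variables (L : Type) (n : nat).
Implicit Types (x : {ffun 'I_n -> L}) (y : {ffun 'I_n.-1 -> L}).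

Definition upd x (i : 'I_n) (u : L) : {ffun 'I_n -> L} :=
  [ffun j => if j == i then u else x j].

(* For n >= 1: (b, y_1, ..., y_{n-1}) and (y_1, ..., y_{n-1}, b). In [fcons]  *)
(* the default value of [oapp] is never used; in [fsnoc] it is used exactly at *)
(* the last index n-1, which [insub] rejects as an element of 'I_n.-1.         *)
Definition fcons (b : L) y : {ffun 'I_n -> L} :=
  [ffun i => if val i is k.+1 then oapp y b (insub k) else b].

Definition fsnoc y (b : L) : {ffun 'I_n -> L} :=
  [ffun i => oapp y b (insub (val i))].

End Families.

Section Multilinear.
Variables (K : comPzRingType) (L M : lmodType K) (m : nat).
Variable f : {ffun 'I_m -> L} -> M.

Definition multilinear : Prop :=
  forall (x : {ffun 'I_m -> L}) (i : 'I_m), linear (fun u => f (upd x i u)).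

Definition alternating : Prop :=
  forall (x : {ffun 'I_m -> L}) (i j : 'I_m), i != j -> x i = x j -> f x = 0.

End Multilinear.

(* The exterior power of degree m of L, by generators and relations. A formal  *)
(* linear combination of generators is a list of pairs (a, x) standing for     *)
(* a x_1 /\ ... /\ x_m; [ext_rel] is the congruence which makes such lists a   *)
(* K-module in which the generators are multilinear and alternating in x.      *)
Section ExteriorPower.
Variables (K : comPzRingType) (L : lmodType K) (m : nat).

Local Notation gen := {ffun 'I_m -> L}.
Local Notation formal := (seq (K * gen)).

Inductive ext_rel : formal -> formal -> Prop :=
| ext_refl s : ext_rel s s
| ext_sym s t : ext_rel s t -> ext_rel t s
| ext_trans s t r : ext_rel s t -> ext_rel t r -> ext_rel s r
| ext_cat s s' t t' :
    ext_rel s s' -> ext_rel t t' -> ext_rel (s ++ t) (s' ++ t')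
| ext_catC s t : ext_rel (s ++ t) (t ++ s)
| ext_coef0 (x : gen) : ext_rel [:: (0, x)] [::]
| ext_coefD a b (x : gen) : ext_rel [:: (a, x); (b, x)] [:: (a + b, x)]
| ext_linear c (x : gen) i a u v :
    ext_rel [:: (c, upd x i (a *: u + v))]
            [:: (c * a, upd x i u); (c, upd x i v)]
| ext_alternating c (x : gen) i j :
    i != j -> x i = x j -> ext_rel [:: (c, x)] [::].

Definition ext_equiv (s t : formal) : bool := `[< ext_rel s t >].

Lemma ext_equiv_class : equiv_class_of ext_equiv.
Proof.
split=> [s|s t|s t r].
- exact/asboolP/ext_refl.
- by apply/asboolP/asboolP; apply: ext_sym.
- by move=> /asboolP st /asboolP tr; apply/asboolP/(ext_trans st tr).
Qed.

Canonical ext_equivRel := EquivRelPack ext_equiv_class.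
Canonical ext_encModRel := defaultEncModRel ext_equiv.

Definition extpow := {eq_quot ext_equiv}.

HB.instance Definition _ : EqQuotient formal ext_equiv extpow :=
  EqQuotient.on extpow.
HB.instance Definition _ := Choice.on extpow.

Lemma ext_piP (s t : formal) :
  ext_rel s t <-> \pi_extpow s = \pi_extpow t.
Proof.
split=> [st|/eqmodP /asboolP //]; exact/eqmodP/asboolP.
Qed.

Variant ext_pi_spec : extpow -> Prop := ExtPi s : ext_pi_spec (\pi_extpow s).

Lemma ext_piW (p : extpow) : ext_pi_spec p.
Proof. by rewrite -[p]reprK. Qed.

Lemma ext_repr_pi (s : formal) : ext_rel (repr (\pi_extpow s)) s.
Proof. by apply/ext_piP; rewrite reprK. Qed.

Definition fscale (a : K) (s : formal) : formal :=
  [seq (a * p.1, p.2) | p <- s].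

Lemma ext_scale a s t : ext_rel s t -> ext_rel (fscale a s) (fscale a t).
Proof.
elim=> {s t} [s|s t _ st|s t r _ st _ tr|s s' t t' _ ss' _ tt'|s t|x|b c x
  |c x i b u v|c x i j ij xij] /=.
- exact: ext_refl.
- exact: ext_sym.
- exact: ext_trans st tr.
- by rewrite /fscale !map_cat; apply: ext_cat.
- by rewrite /fscale !map_cat; apply: ext_catC.
- by rewrite mulr0; apply: ext_coef0.
- by rewrite mulrDr; apply: ext_coefD.
- by rewrite mulrA; apply: ext_linear.
- exact: ext_alternating ij xij.
Qed.

Definition ext_zero : extpow := \pi_extpow [::].
Definition ext_add (p q : extpow) : extpow := \pi_extpow (repr p ++ repr q).
Definition ext_scal (a : K) (p : extpow) : extpow :=
  \pi_extpow (fscale a (repr p)).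
Definition ext_opp (p : extpow) : extpow := ext_scal (-1) p.

Lemma ext_add_pi s t :
  ext_add (\pi_extpow s) (\pi_extpow t) = \pi_extpow (s ++ t).
Proof. by apply/ext_piP; apply: ext_cat; apply: ext_repr_pi. Qed.

Lemma ext_scal_pi a s : ext_scal a (\pi_extpow s) = \pi_extpow (fscale a s).
Proof. by apply/ext_piP; apply: ext_scale; apply: ext_repr_pi. Qed.

Lemma ext_addA : associative ext_add.
Proof.
by case/ext_piW=> s; case/ext_piW=> t; case/ext_piW=> r; rewrite !ext_add_pi catA.
Qed.

Lemma ext_addC : commutative ext_add.
Proof.
case/ext_piW=> s; case/ext_piW=> t; rewrite !ext_add_pi; exact/ext_piP/ext_catC.
Qed.

Lemma ext_add0 : left_id ext_zero ext_add.
Proof. by case/ext_piW=> s; rewrite ext_add_pi. Qed.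

Lemma fscaleDl a b s : ext_rel (fscale a s ++ fscale b s) (fscale (a + b) s).
Proof.
elim: s => [|[c x] s IHs] /=; first exact: ext_refl.
rewrite mulrDl; apply: ext_trans _ (ext_cat (ext_coefD _ _ _) IHs).
apply: (@ext_cat [:: (a * c, x)] [:: (a * c, x)] _ _ (ext_refl _)).
rewrite -cat_rcons -cats1.
exact: (ext_cat (ext_catC (fscale a s) [:: (b * c, x)]) (ext_refl (fscale b s))).
Qed.

Lemma fscale1 s : fscale 1 s = s.
Proof. by rewrite /fscale -[RHS]map_id; apply: eq_map => -[c x]; rewrite /= mul1r. Qed.

Lemma fscale0 s : ext_rel (fscale 0 s) [::].
Proof.
elim: s => [|[c x] s IHs] /=; first exact: ext_refl.
rewrite mul0r -cat1s -[[::]]cat0s; exact: ext_cat (ext_coef0 _) IHs.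
Qed.

Lemma ext_addN : left_inverse ext_zero ext_opp ext_add.
Proof.
case/ext_piW=> s; rewrite /ext_opp ext_scal_pi ext_add_pi; apply/ext_piP.
rewrite -{2}[s]fscale1; apply: ext_trans (fscaleDl _ _ _) _.
by rewrite addNr; apply: fscale0.
Qed.

HB.instance Definition _ :=
  GRing.isZmodule.Build extpow ext_addA ext_addC ext_add0 ext_addN.

Lemma ext_scalA a b p : ext_scal a (ext_scal b p) = ext_scal (a * b) p.
Proof.
case/ext_piW: p => s; rewrite !ext_scal_pi /fscale -map_comp; congr (\pi _).
by apply: eq_map => -[c x] /=; rewrite mulrA.
Qed.

Lemma ext_scal1 : left_id 1 ext_scal.
Proof. by case/ext_piW=> s; rewrite ext_scal_pi fscale1. Qed.

Lemma ext_scalDr : right_distributive ext_scal +%R.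
Proof.
move=> a; case/ext_piW=> s; case/ext_piW=> t.
rewrite -[_ + _]/(ext_add _ _) -[RHS]/(ext_add _ _).
by rewrite !(ext_add_pi, ext_scal_pi) /fscale map_cat.
Qed.

Lemma ext_scalDl p : {morph ext_scal^~ p : a b / a + b}.
Proof.
case/ext_piW: p => s a b /=; rewrite -[RHS]/(ext_add _ _).
rewrite !ext_scal_pi ext_add_pi; apply/ext_piP/ext_sym/fscaleDl.
Qed.

HB.instance Definition _ :=
  GRing.Zmodule_isLmodule.Build K extpow ext_scalA ext_scal1 ext_scalDr ext_scalDl.

Lemma pi_cat s t : \pi_extpow (s ++ t) = \pi_extpow s + \pi_extpow t.
Proof. by rewrite -ext_add_pi. Qed.

Lemma pi_fscale a s : \pi_extpow (fscale a s) = a *: \pi_extpow s.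
Proof. by rewrite -ext_scal_pi. Qed.

Definition wedge (x : gen) : extpow := \pi_extpow [:: (1, x)].

Lemma pi_wedge s : \pi_extpow s = \sum_(p <- s) p.1 *: wedge p.2.
Proof.
elim: s => [|[c x] s IHs]; first by rewrite big_nil.
by rewrite big_cons -IHs -pi_fscale -pi_cat /= mulr1.
Qed.

Lemma extpow_wedge (p : extpow) :
  exists s : formal, p = \sum_(q <- s) q.1 *: wedge q.2.
Proof. by case/ext_piW: p => s; exists s; rewrite pi_wedge. Qed.

Lemma wedge_multilinear : multilinear wedge.
Proof.
move=> x i a u v /=; rewrite /wedge -pi_fscale -pi_cat /= mulrC.
exact/ext_piP/ext_linear.
Qed.

Lemma wedge_alternating : alternating wedge.
Proof. by move=> x i j ij xij; apply/ext_piP/(ext_alternating _ ij xij). Qed.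

(* The linear extension of f to the exterior power; it depends on the chosen   *)
(* representative unless f is multilinear and alternating.                     *)
Definition ext_lift (M : lmodType K) (f : gen -> M) (p : extpow) : M :=
  \sum_(q <- repr p) q.1 *: f q.2.

Section Lift.
Variables (M : lmodType K) (f : gen -> M).
Hypotheses (fmul : multilinear f) (falt : alternating f).

Lemma ext_rel_lift s t : ext_rel s t ->
  \sum_(q <- s) q.1 *: f q.2 = \sum_(q <- t) q.1 *: f q.2.
Proof.
elim=> {s t} [//|s t _ -> //|s t r _ -> //|s s' t t' _ e1 _ e2|s t|x|b c x
  |c x i b u v|c x i j ij xij] /=.
- by rewrite !big_cat /= e1 e2.
- by rewrite !big_cat /= addrC.
- by rewrite big_seq1 big_nil scale0r.
- by rewrite big_cons !big_seq1 /= scalerDl.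
- by rewrite !big_cons !big_nil !addr0 /= fmul scalerDr scalerA.
- by rewrite big_seq1 big_nil /= (falt ij xij) scaler0.
Qed.

Lemma ext_lift_pi s : ext_lift f (\pi_extpow s) = \sum_(q <- s) q.1 *: f q.2.
Proof. exact: ext_rel_lift (ext_repr_pi s). Qed.

Lemma ext_lift_wedge x : ext_lift f (wedge x) = f x.
Proof. by rewrite ext_lift_pi big_seq1 scale1r. Qed.

Lemma ext_lift_linear : linear (ext_lift f).
Proof.
move=> a; case/ext_piW=> s; case/ext_piW=> t.
rewrite -pi_fscale -pi_cat !ext_lift_pi big_cat /= scaler_sumr big_map.
by congr (_ + _); apply: eq_bigr => q _; rewrite scalerA.
Qed.

Lemma ext_lift_uniq (g : extpow -> M) :
  linear g -> (forall x, g (wedge x) = f x) -> g =1 ext_lift f.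
Proof.
move=> glin gw; case/ext_piW=> s; rewrite ext_lift_pi pi_wedge.
have g0 : g 0 = 0.
  by have := glin (-1) 0 0; rewrite scaler0 addr0 scaleN1r addNr.
elim: s => [|q s IHs]; first by rewrite !big_nil.
by rewrite !big_cons glin IHs gw.
Qed.

End Lift.
End ExteriorPower.

Section NLie.
Variables (K : comPzRingType) (n : nat) (L : lmodType K).
Variable br : {ffun 'I_n -> L} -> L.

Record nLie_algebra : Prop := NLieAlgebra {
  nLie_multilinear : multilinear br;
  nLie_alternating : alternating br;
  nLie_identity : forall (x : {ffun 'I_n -> L}) (y : {ffun 'I_n.-1 -> L}),
    br (fcons (br x) y) = \sum_(i < n) br (upd x i (br (fcons (x i) y)))
}.

Definition ad (x : extpow L n.-1) (b : L) : L :=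
  ext_lift (fun y => br (fsnoc y b)) x.

(* The extension by derivation of a linear map d : L -> L. *)
Definition ext_der (d : L -> L) : extpow L n.-1 -> extpow L n.-1 :=
  ext_lift (fun y => \sum_(k < n.-1) wedge (upd y k (d (y k)))).

(* InnDer(L), the K-span of the maps [ad x], as a predicate on maps L -> L.    *)
Definition in_InnDer (d : L -> L) : Prop :=
  exists s : seq (K * extpow L n.-1),
    forall b, d b = \sum_(p <- s) p.1 *: ad p.2 b.

Definition commutator (d1 d2 : L -> L) (b : L) : L := d1 (d2 b) - d2 (d1 b).

Definition InnDer_abelian : Prop :=
  forall d1 d2, in_InnDer d1 -> in_InnDer d2 -> forall b, commutator d1 d2 b = 0.

(* K need not come with an inverse operation: [half] is to be an inverse of 2. *)
Definition circ (half : K) (x y : extpow L n.-1) : extpow L n.-1 :=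
  half *: (ext_der (ad x) y - ext_der (ad y) x).

End NLie.

Record Lie_algebra (K : comPzRingType) (V : lmodType K) (br : V -> V -> V) : Prop :=
  LieAlgebra {
    Lie_linearl : forall y, linear (fun x => br x y);
    Lie_linearr : forall x, linear (br x);
    Lie_alternating : forall x, br x x = 0;
    Lie_jacobi : forall x y z,
      br x (br y z) + br y (br z x) + br z (br x y) = 0
  }.

(* Defining equations of [ad] and [ext_der] on decomposable elements. *)
Section NLieSpec.
Variables (K : comPzRingType) (n : nat) (L : lmodType K).

Lemma fsnoc_upd (y : {ffun 'I_n.-1 -> L}) (b : L) (i : 'I_n.-1) (u : L) :
  fsnoc (upd y i u) b = upd (fsnoc y b) (widen_ord (leq_pred n) i) u.
Proof.
apply/ffunP=> j; rewrite !ffunE; case: insubP => [k _ kj|] /=.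
  by rewrite ffunE -!val_eqE /= kj.
case: eqP => // -> /=; by rewrite ltn_ord.
Qed.

Section Ext.
Variables (d : L -> L) (dlin : linear d).

Let F := fun y : {ffun 'I_n.-1 -> L} =>
  \sum_(k < n.-1) wedge (upd y k (d (y k))).

Lemma updd m (y : {ffun 'I_m -> L}) i u v : upd (upd y i u) i v = upd y i v.
Proof. by apply/ffunP=> j; rewrite !ffunE; case: eqP. Qed.

Lemma updC m (y : {ffun 'I_m -> L}) i j u v : i != j ->
  upd (upd y i u) j v = upd (upd y j v) i u.
Proof.
move=> ij; apply/ffunP=> k; rewrite !ffunE.
by case: (k =P j) => [->|//]; rewrite eq_sym (negPf ij).
Qed.

Lemma ext_der_multilinear : multilinear F.
Proof.
move=> y i a u v; rewrite /F /= scaler_sumr -big_split /=.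
apply: eq_bigr => k _; have [->|ki] := eqVneq k i.
  by rewrite !updd !ffunE eqxx dlin wedge_multilinear.
rewrite !ffunE (negPf ki) !(updC _ _ _ (_ : i != k)) 1?eq_sym //.
exact: wedge_multilinear.
Qed.

Lemma wedge_swap m (y : {ffun 'I_m -> L}) i j u v : i != j ->
  wedge (upd (upd y i u) j v) = - wedge (upd (upd y i v) j u).
Proof.
move=> ij; apply/eqP; rewrite -addr_eq0; apply/eqP.
have wD (z : {ffun 'I_m -> L}) k a b : wedge (upd z k (a + b)) =
    wedge (upd z k a) + wedge (upd z k b).
  by have := wedge_multilinear z k 1 a b; rewrite !scale1r.
have w0 w : wedge (upd (upd y i w) j w) = 0.
  by apply: (wedge_alternating ij); rewrite !ffunE eqxx (negPf ij) eqxx.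
have wDl a b c : wedge (upd (upd y i (a + b)) j c) =
    wedge (upd (upd y i a) j c) + wedge (upd (upd y i b) j c).
  by rewrite !(updC _ _ _ ij) wD.
by have := w0 (u + v); rewrite wD !wDl !w0 add0r addr0 addrC.
Qed.

Lemma ext_der_alternating : alternating F.
Proof.
move=> y i j ij yij; rewrite /F (bigD1 i) //= (bigD1 j) 1?eq_sym //=.
rewrite big1 ?addr0 => [|k /andP[ki kj]]; last first.
  apply: (wedge_alternating ij).
  by rewrite !ffunE ![_ == k]eq_sym (negPf ki) (negPf kj).
have updid m (z : {ffun 'I_m -> L}) k : upd z k (z k) = z.
  by apply/ffunP=> l; rewrite !ffunE; case: eqP => [->|].
rewrite -{1}(updid _ y j) -[X in _ + wedge (upd X _ _)](updid _ y i).
rewrite (updC _ _ _ (_ : j != i)) 1?eq_sym // wedge_swap // yij.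
exact: addNr.
Qed.

Lemma ext_der_wedge y :
  ext_der d (wedge y) = \sum_(k < n.-1) wedge (upd y k (d (y k))).
Proof. exact: ext_lift_wedge ext_der_multilinear ext_der_alternating y. Qed.

Lemma ext_der_linear : linear (@ext_der K n L d).
Proof. exact: ext_lift_linear ext_der_multilinear ext_der_alternating. Qed.

End Ext.

Variable br : {ffun 'I_n -> L} -> L.
Hypotheses (n_gt1 : (1 < n)%N) (brL : nLie_algebra br).

Lemma ad_multilinear b : multilinear (fun y => br (fsnoc y b)).
Proof. by move=> y i a u v; rewrite !fsnoc_upd (nLie_multilinear brL). Qed.

Lemma ad_alternating b : alternating (fun y => br (fsnoc y b)).
Proof.
move=> y i j ij yij.
apply: (nLie_alternating brL (i := widen_ord (leq_pred n) i)
          (j := widen_ord (leq_pred n) j)) => //.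
by rewrite !ffunE /= !valK.
Qed.

Lemma ad_wedge y b : ad br (wedge y) b = br (fsnoc y b).
Proof. exact: ext_lift_wedge (ad_multilinear b) (ad_alternating b) y. Qed.

Lemma ad_linearl b : linear (fun x => ad br x b).
Proof. exact: ext_lift_linear (ad_multilinear b) (ad_alternating b). Qed.

Lemma ad_linearr x : linear (ad br x).
Proof.
move=> a u v; rewrite /ad /ext_lift scaler_sumr -big_split /=.
apply: eq_bigr => q _; rewrite scalerA [a * _]mulrC -scalerA -scalerDr.
have lt_n : (n.-1 < n)%N by rewrite prednK // ltnW.
have snocE b : fsnoc q.2 b = upd (fsnoc q.2 0) (Ordinal lt_n) b.
  apply/ffunP=> j; rewrite !ffunE -val_eqE /=; case: insubP => [k _ kj|] /=.
    by rewrite -kj ltn_eqF ?ltn_ord.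
  rewrite -leqNgt => le_nj; rewrite eqn_leq le_nj andbT.
  by rewrite -ltnS prednK ?ltn_ord // ltnW.
by rewrite (snocE (a *: u + v)) (snocE u) (snocE v) (nLie_multilinear brL).
Qed.

End NLieSpec.

(* Main.v *)
(** Write x.y for [ext_der (ad x) y]. Every derivation D of L satisfies
    [D, ad y] = ad (D.y), so when the inner derivations commute ad (x.y) = 0,
    and all products (x.y).z vanish. Hence ad (y o z) = 0, and
    4 x o (y o z) = x.(y.z) - x.(z.y), whose cyclic sum is zero because
    x.(y.z) = y.(x.z). *)
From HB Require Import structures.
Require Import Defs.
From mathcomp Require Import all_boot all_order all_algebra all_fingroup.

Set Implicit Arguments.
Unset Strict Implicit.
Unset Printing Implicit Defensive.

Import GRing.Theory.

Local Open Scope ring_scope.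

(** Lifts to the exterior power are linear only under hypotheses on the lifted map. The bundled copy
    opens them to [linear_sum] and [linearZ]. *)
Lemma linear_bundle (K : comPzRingType) (U V : lmodType K) (f : U -> V) :
  linear f -> exists g : {linear U -> V}, g =1 f.
Proof.
move=> f_lin.
pose f_mixin := GRing.isLinear.Build K U V *:%R f f_lin.
by exists (HB.pack f f_mixin : {linear U -> V}).
Qed.

Lemma extpow_linear_eq (K : comPzRingType) (L M : lmodType K) (m : nat)
    (f g : extpow L m -> M) :
  linear f -> linear g -> (forall x, f (wedge x) = g (wedge x)) -> f =1 g.
Proof.
move=> /linear_bundle[F FE] /linear_bundle[G GE] fg x.
have [s ->] := extpow_wedge x.
rewrite -FE -GE !linear_sum; apply: eq_bigr => p _.
by rewrite !linearZ /= FE GE fg.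
Qed.

Section Alternating.
Variables (K : comPzRingType) (L M : lmodType K) (m : nat).
Variable f : {ffun 'I_m -> L} -> M.
Hypotheses (f_mul : multilinear f) (f_alt : alternating f).

Lemma upd_id (z : {ffun 'I_m -> L}) i : upd z i (z i) = z.
Proof. by apply/ffunP=> j; rewrite ffunE; case: eqP => [->|]. Qed.

(** Since [f] factors through the exterior power, the sign is that of [wedge_swap]. *)
Lemma alternating_tperm (z : {ffun 'I_m -> L}) i j : i != j ->
  f [ffun k => z (tperm i j k)] = - f z.
Proof.
move=> ij; have [F FE] := linear_bundle (ext_lift_linear f_mul f_alt).
rewrite -!(ext_lift_wedge f_mul f_alt) -!FE -linearN; congr (F _).
have -> : [ffun k => z (tperm i j k)] = upd (upd z i (z j)) j (z i).
  apply/ffunP=> k; rewrite !ffunE.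
  case: tpermP => [->|->|/eqP/negPf-> /eqP/negPf->//].
    by rewrite (negPf ij) eqxx.
  by rewrite eqxx.
by rewrite wedge_swap // upd_id upd_id.
Qed.

(** Each transposition in a factorization of [s] contributes -1, whatever [z] is. *)
Lemma alternating_perm (s : {perm 'I_m}) :
  exists c : K, forall z : {ffun 'I_m -> L}, f [ffun k => z (s k)] = c *: f z.
Proof.
have [ts -> {s}] := prod_tpermP s.
elim: ts => [_|[i j] ts IHts /= /andP[ij /IHts[c fc]]].
  exists 1 => z; rewrite scale1r big_nil; congr (f _).
  by apply/ffunP=> k; rewrite ffunE perm1.
exists (- c) => z; rewrite big_cons /= scaleNr -fc -(alternating_tperm _ ij).
by congr (f _); apply/ffunP=> k; rewrite !ffunE permM.
Qed.

End Alternating.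

Section ExtDer.
Variables (K : comPzRingType) (n : nat) (L : lmodType K).
Implicit Types (d : L -> L) (y : extpow L n.-1).

(** All three lifts are evaluated on the same representative of [y], so the identity holds term by
    term for arbitrary maps. *)
Lemma ext_der_lincomb a d1 d2 d y : (forall b, d b = a *: d1 b + d2 b) ->
  ext_der d y = a *: ext_der d1 y + ext_der d2 y.
Proof.
move=> dE; rewrite /ext_der /ext_lift scaler_sumr -big_split /=.
apply: eq_bigr => q _; rewrite scalerA [a * _]mulrC -scalerA -scalerDr.
congr (_ *: _); rewrite scaler_sumr -big_split /=; apply: eq_bigr => k _.
by rewrite dE wedge_multilinear.
Qed.

Lemma ext_der0 d y : (forall b, d b = 0) -> ext_der d y = 0.
Proof.
(* A zero map satisfies d = -d + d, which makes [ext_der d y] a difference of equal terms. *)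
move=> d0; rewrite (@ext_der_lincomb (-1) d d) => [|b].
  by rewrite scaleN1r addNr.
by rewrite d0 scaler0 addr0.
Qed.

(** On a decomposable element both sides are double sums over slots: updates in distinct slots
    commute, and on the diagonal the hypothesis on [d1] and [d2] applies. *)
Lemma ext_der_commute d1 d2 : linear d1 -> linear d2 ->
    (forall b, d1 (d2 b) = d2 (d1 b)) ->
  forall y, ext_der d1 (ext_der d2 y) = ext_der d2 (ext_der d1 y).
Proof.
move=> lin1 lin2 d12.
have [D1 D1E] := linear_bundle (@ext_der_linear _ n _ _ lin1).
have [D2 D2E] := linear_bundle (@ext_der_linear _ n _ _ lin2).
suff eqD : (D1 \o D2 : _ -> _) =1 D2 \o D1.
  by move=> y; have := eqD y; rewrite /= !D1E !D2E.
apply: extpow_linear_eq => [||x]; try exact: linearP.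
rewrite /= (D2E (wedge x)) (D1E (wedge x)) !ext_der_wedge // !linear_sum /=.
under eq_bigr do rewrite D1E ext_der_wedge //.
under [RHS]eq_bigr do rewrite D2E ext_der_wedge //.
rewrite [RHS]exchange_big /=.
apply: eq_bigr => k _; apply: eq_bigr => l _; rewrite !ffunE.
have [->|lk] := eqVneq l k; first by rewrite !updd d12.
by rewrite updC // eq_sym.
Qed.

End ExtDer.

(** Variant of [big_ord_recr] for [n] not displayed as a successor, with the embedding of indices
    used in [fsnoc_upd]. *)
Lemma sum_ord_last (V : nmodType) n (n_gt0 : (n.-1 < n)%N) (F : 'I_n -> V) :
  \sum_(i < n) F i =
  \sum_(k < n.-1) F (widen_ord (leq_pred n) k) + F (Ordinal n_gt0).
Proof.
case: n n_gt0 F => // n n_gt0 F; rewrite big_ord_recr /=; congr (_ + F _).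
  by apply: eq_bigr => k _; congr (F _); apply: val_inj.
exact: val_inj.
Qed.

Section NLie.
Variables (K : comPzRingType) (n : nat) (L : lmodType K).
Variable br : {ffun 'I_n -> L} -> L.
Hypotheses (n_gt1 : (1 < n)%N) (brL : nLie_algebra br).

Definition derivation (d : L -> L) : Prop :=
  forall z, d (br z) = \sum_(i < n) br (upd z i (d (z i))).

(* [nLie_identity] puts the acting vectors last, [ad] puts them first; a cyclic
   permutation relates the two up to a sign. *)
Lemma fsnoc_fcons (y : {ffun 'I_n.-1 -> L}) b :
  fsnoc y b = [ffun k => fcons b y (perm (@ordS_inj n) k)].
Proof.
apply/ffunP=> k; rewrite !ffunE permE /=.
have [kn|] := ltnP k.+1 n; first by rewrite modn_small.
rewrite leq_eqVlt ltnS leqNgt ltn_ord orbF => /eqP kn.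
(* At the last index the cyclic shift wraps around to 0, the slot of [b] in [fcons]. *)
by rewrite -kn modnn insubF //= ltn_predRL -kn ltnn.
Qed.

Lemma br_fsnoc :
  exists c : K, forall y b, br (fsnoc y b) = c *: br (fcons b y).
Proof.
have [c cE] := alternating_perm (nLie_multilinear brL) (nLie_alternating brL)
  (perm (@ordS_inj n)).
by exists c => y b; rewrite fsnoc_fcons cE.
Qed.

(** By linearity in [x] it is enough to treat decomposable elements; there the claim is
    [nLie_identity] with both sides multiplied by the scalar of [br_fsnoc]. *)
Lemma ad_derivation x : derivation (ad br x).
Proof.
move=> z; have [c cE] := br_fsnoc.
have br_linear i := linear_bundle (nLie_multilinear brL z i).
have ad_lin := ad_linearl brL.
pose D x' := \sum_(i < n) br (upd z i (ad br x' (z i))).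
apply: (@extpow_linear_eq _ _ _ _ (fun x => ad br x _) D) => {x} // [a u v|x].
  rewrite /D scaler_sumr -big_split /=; apply: eq_bigr => i _.
  by rewrite ad_lin (nLie_multilinear brL).
rewrite /D ad_wedge // cE (nLie_identity brL) scaler_sumr.
apply: eq_bigr => i _; rewrite ad_wedge // cE.
by have [B BE] := br_linear i; rewrite -!BE linearZ.
Qed.

(** For decomposable [y], expanding [d (ad br y b)] gives one term per slot: the slot of [b] yields
    the subtracted term, the others make up the left-hand side. *)
Lemma ad_ext_der d : linear d -> derivation d ->
  forall y b, ad br (ext_der d y) b = d (ad br y b) - ad br y (d b).
Proof.
move=> d_lin d_der y b; move: y.
have [D DE] := linear_bundle d_lin.
have [E EE] := linear_bundle (@ext_der_linear _ n _ _ d_lin).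
have [A AE] := linear_bundle (ad_linearl brL b).
have [A' A'E] := linear_bundle (ad_linearl brL (d b)).
suff eqD : (A \o E : _ -> _) =1 (fun y => D (A y) - A' y).
  by move=> y; have := eqD y; rewrite /= AE EE A'E DE AE.
apply: extpow_linear_eq => [|a u v|x]; first exact: linearP.
  by rewrite !linearP /= scalerBr scalerN addrACA.
rewrite /= EE ext_der_wedge // linear_sum /= A'E AE DE !ad_wedge // d_der.
have lt_n : (n.-1 < n)%N by rewrite prednK // ltnW.
have n_eq : n.-1.+1 = n by rewrite prednK // ltnW.
rewrite (sum_ord_last lt_n).
have snocE u : fsnoc x u (Ordinal lt_n) = u by rewrite ffunE insubF //= ltnn.
have -> : upd (fsnoc x b) (Ordinal lt_n) (d (fsnoc x b (Ordinal lt_n)))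
    = fsnoc x (d b).
  apply/ffunP=> j; rewrite snocE !ffunE -val_eqE /=; case: eqP => [->|/eqP nj].
    by rewrite insubF //= ltnn.
  have lj : (j < n.-1)%N by rewrite ltn_neqAle nj -ltnS n_eq ltn_ord.
  by rewrite (insubT (fun i => (i < n.-1)%N) lj).
rewrite addrK; apply: eq_bigr => k _.
by rewrite AE ad_wedge // fsnoc_upd [fsnoc x b _]ffunE valK.
Qed.

End NLie.

Theorem corollary3p3 (K : comPzRingType) (half : K) (half2 : 2%:R * half = 1)
  (n : nat) (n_ge2 : (2 <= n)%N)
  (L : lmodType K) (br : {ffun 'I_n -> L} -> L) (brL : nLie_algebra br)
  (abel : InnDer_abelian br) :
  Lie_algebra (circ br half).
Proof.
have ad_lin := ad_linearr n_ge2 brL.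
have in_ad x : in_InnDer br (ad br x).
  by exists [:: (1, x)] => b; rewrite big_seq1 scale1r.
have adC x y b : ad br x (ad br y b) = ad br y (ad br x b).
  by apply/eqP; rewrite -subr_eq0; apply/eqP/abel.
have ad_der0 x y b : ad br (ext_der (ad br x) y) b = 0.
  have x_der := ad_derivation brL x.
  by rewrite (ad_ext_der n_ge2 brL (ad_lin x) x_der) (adC x) subrr.
have ad_circ0 x y b : ad br (circ br half x y) b = 0.
  have [A AE] := linear_bundle (ad_linearl brL b).
  by rewrite -AE linearZ linearB /= !AE !ad_der0 subrr scaler0.
have ext_derDl a x x' (y : extpow L n.-1) : ext_der (ad br (a *: x + x')) y =
    a *: ext_der (ad br x) y + ext_der (ad br x') y.
  by apply: ext_der_lincomb => b; rewrite (ad_linearl brL).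
have ext_derDr x a (y y' : extpow L n.-1) : ext_der (ad br x) (a *: y + y') =
    a *: ext_der (ad br x) y + ext_der (ad br x) y'.
  exact: ext_der_linear.
have halfC a (u v : extpow L n.-1) :
    half *: (a *: u + v) = a *: (half *: u) + half *: v.
  by rewrite scalerDr !scalerA mulrC.
split=> [y a x x'|x a y y'|x|x y z].
- by rewrite /circ ext_derDl ext_derDr opprD addrACA -scalerBr halfC.
- by rewrite /circ ext_derDl ext_derDr opprD addrACA -scalerBr halfC.
- by rewrite /circ subrr scaler0.
pose t x y (z : extpow L n.-1) := ext_der (ad br x) (ext_der (ad br y) z).
(* The other half of the outer product is the action of [ad br (circ br half y' z')], which is
   zero. *)
have circ_circ x' y' z' : circ br half x' (circ br half y' z') =
    half *: (half *: (t x' y' z' - t x' z' y')).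
  rewrite {1}/circ (ext_der0 _ (ad_circ0 y' z')) subr0; congr (_ *: _).
  have [E EE] := linear_bundle (@ext_der_linear _ n _ _ (ad_lin x')).
  by rewrite /circ -EE linearZ linearB /= !EE.
have tC x' y' z' : t x' y' z' = t y' x' z' by apply: ext_der_commute.
(* With A = [t x y z], B = [t z x y], C = [t y z x], the cyclic sum becomes (A - B) + (C - A) + (B -
   C); swapping the first two differences makes it telescope. *)
rewrite !circ_circ -!scalerDr (tC x z) (tC y x) (tC z y).
by rewrite [X in X + _]addrC !subrKA subrr !scaler0.
Qed.
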